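(* Let $\mathbb{K}$ be a field, let $V$ be an $n$-dimensional $\mathbb{K}$-vector space, and let $\underline{\phi}=(\phi_1,\ldots,\phi_n)\in \mathrm{End}_{\mathbb{K}}(V)^n$ be an ordered $n$-tuple of endomorphisms of $V$. Let $\tau_{\underline{i}}(\underline{\phi})\in\mathbb{K}$ denote the $\underline{i}$-trace of $\underline{\phi}$, for $\underline{i}\in\mathbb{N}^n$. Then the following identity holds in $\mathrm{End}_{\mathbb{K}}(V)$: $$ \sum_{k=0}^n(-1)^k\frac{1}{k!}\sum_{\sigma\in S_n}\tau_{\mathbf{e}_{\sigma(1)}+\cdots+\mathbf{e}_{\sigma(k)}}(\underline{\phi})\cdot \bigl(\phi_{\sigma(k+1)}\circ \cdots \circ \phi_{\sigma(n)}\bigr)=0, $$ where $(\mathbf{e}_1,\ldots,\mathbf{e}_n)$ is the canonical basis of $\mathbb{Z}^n$ and $S_n$ is the symmetric group on $n$ letters.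
   Context: Notation: $\bigwedge V=\bigoplus_{j\ge 0}\bigwedge^jV$ is the exterior algebra of the $n$-dimensional $\mathbb{K}$-vector space $V$; $\underline{z}=(z_1,\ldots,z_n)$ are $n$ formal variables; for $\underline{i}=(i_1,\ldots,i_n)\in\mathbb{N}^n$ (with $0\in\mathbb{N}$) put $\underline{z}^{\underline{i}}=z_1^{i_1}\cdots z_n^{i_n}$ and $|\underline{i}|=i_1+\cdots+i_n$; $\bigwedge V[[\underline{z}]]$ is the algebra of formal power series in $\underline{z}$ with coefficients in $\bigwedge V$ (the variables commute with everything). Multivariate HS-derivation: an ($n$-)multivariate Hasse–Schmidt derivation on $\bigwedge V$ is a $\mathbb{K}$-algebra homomorphism $\mathcal{D}(\underline{z}):\bigwedge V\to\bigwedge V[[\underline{z}]]$, i.e. a $\mathbb{K}$-linear map with $\mathcal{D}(\underline{z})(1)=1$ and $\mathcal{D}(\underline{z})(u\wedge v)=\mathcal{D}(\underline{z})u\wedge\mathcal{D}(\underline{z})v$ for all $u,v\in\bigwedge V$. Given $\underline{\phi}=(\phi_1,\ldots,\phi_n)\in\mathrm{End}_{\mathbb{K}}(V)^n$, let $\overline{\mathcal{D}}(\underline{z})$ be the unique multivariate HS-derivation on $\bigwedge V$ whose restriction to $V=\bigwedge^1V$ is $\mathrm{id}_V-(\phi_1z_1+\cdots+\phi_nz_n)$; explicitly $\overline{\mathcal{D}}(\underline{z})(v_1\wedge\cdots\wedge v_k)=\overline{\mathcal{D}}(\underline{z})v_1\wedge\cdots\wedge\overline{\mathcal{D}}(\underline{z})v_k$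 for $v_1,\dots,v_k\in V$. Write $\overline{\mathcal{D}}(\underline{z})=\sum_{\underline{i}\in\mathbb{N}^n}(-1)^{|\underline{i}|}\overline{D}_{\underline{i}}\,\underline{z}^{\underline{i}}$ with $\overline{D}_{\underline{i}}\in\mathrm{End}_{\mathbb{K}}(\bigwedge V)$. Each $\overline{D}_{\underline{i}}$ maps the one-dimensional space $\bigwedge^nV$ to itself. Trace: the $\underline{i}$-trace $\tau_{\underline{i}}(\underline{\phi})\in\mathbb{K}$ is the scalar defined by $\tau_{\underline{i}}(\underline{\phi})\,\xi=\overline{D}_{\underline{i}}\xi$ for any nonzero $\xi\in\bigwedge^nV$. Conventions: the summand for $k=0$ is $\sum_{\sigma\in S_n}\phi_{\sigma(1)}\circ\cdots\circ\phi_{\sigma(n)}$ (since $\tau_{\underline{0}}(\underline{\phi})=1$); for $k=n$ the empty composition is $\mathrm{id}_V$, so that the summand is $(-1)^n\tau_{(1,\ldots,1)}(\underline{\phi})\,\mathrm{id}_V$. For each $k$, the term indexed by $\sigma$ depends only on $\sigma(k+1),\ldots,\sigma(n)$, so each term is repeated $k!$ times; the factor $\frac{1}{k!}$ removes this repetition. If $k!$ is not invertible in $\mathbb{K}$, the expression $\frac{1}{k!}\sum_{\sigma\in S_n}$ is to be read as the sum over those $\sigma\in S_n$ with $\sigma(1)<\cdots<\sigma(k)$. *)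

(* Defs.v *)
From HB Require Import structures.
From mathcomp Require Import all_boot all_order all_fingroup all_algebra.
From mathcomp Require Import mpoly.

Set Implicit Arguments.
Unset Strict Implicit.
Unset Printing Implicit Defensive.

Import GRing.Theory.
Local Open Scope ring_scope.

(* The exterior algebra is given by its universal property: all the notions    *)
(* below are stated for an arbitrary algebra A with a linear map               *)
(* iota : V -> A satisfying it, and the product of A is the wedge product.     *)
Definition is_exterior_algebra (K : fieldType) (V : vectType K) (A : algType K)
    (iota : {linear V -> A}) : Prop :=
  (forall v : V, iota v * iota v = 0) /\
  (forall (B : algType K) (f : {linear V -> B}),
     (forall v : V, f v * f v = 0) ->
     exists2 g : {lrmorphism A -> B},
       (forall v : V, g (iota v) = f v) &
       (forall h : {lrmorphism A -> B},
          (forall v : V, h (iota v) = f v) -> forall u : A, h u = g u)).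

(* The j-th exterior power, as the span in A of the j-fold wedge products.     *)
Definition in_extpow (K : fieldType) (V : vectType K) (A : algType K)
    (iota : {linear V -> A}) (j : nat) (u : A) : Prop :=
  exists l : seq (K * j.-tuple V),
    u = \sum_(p <- l) p.1 *: \prod_(v <- p.2) iota v.

(* Formal power series in n commuting variables, as families of coefficients   *)
(* indexed by the multi-indices 'X_{1..n} (i.e. elements of N^n).              *)
Definition series (n : nat) (A : Type) : Type := 'X_{1..n} -> A.

Definition series1 (n : nat) (A : nzRingType) : series n A :=
  fun m => if m == 0%MM then 1 else 0.

(* The bounds on k.1 and k.2 only serve to make the sum finite; they are       *)
(* implied by k.1 + k.2 = m.                                                   *)
Definition series_mul (n : nat) (A : nzRingType) (f g : series n A) :
    series n A :=
  fun m => \sum_(k : 'X_{1..n < (mdeg m).+1, (mdeg m).+1}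
                  | m == (k.1 + k.2)%MM) f k.1 * g k.2.

Definition is_HS_derivation (K : fieldType) (n : nat) (A : algType K)
    (D : A -> series n A) : Prop :=
  [/\ forall (a : K) (u v : A) (m : 'X_{1..n}),
        D (a *: u + v) m = a *: D u m + D v m,
      D 1 =1 @series1 n A
    & forall u v : A, D (u * v) =1 series_mul (D u) (D v)].

(* The series (id - (phi_1 z_1 + ... + phi_n z_n)) v, with coefficients in A.  *)
Definition id_sub_series (K : fieldType) (V : vectType K) (A : algType K)
    (iota : {linear V -> A}) (n : nat) (phi : 'I_n -> 'End(V)) (v : V) :
    series n A :=
  fun m => iota v *+ (m == 0%MM) - \sum_(i < n) iota (phi i v) *+ (m == U_(i)%MM).

Definition is_HS_of (K : fieldType) (V : vectType K) (A : algType K)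
    (iota : {linear V -> A}) (n : nat) (phi : 'I_n -> 'End(V))
    (D : A -> series n A) : Prop :=
  is_HS_derivation D /\ (forall v : V, D (iota v) =1 id_sub_series iota phi v).

(* Coefficients are taken with the sign convention                             *)
(* D = \sum_m (-1)^|m| D_m z^m.                                                *)
Definition HS_coef (K : fieldType) (n : nat) (A : algType K)
    (D : A -> series n A) (m : 'X_{1..n}) (u : A) : A :=
  (-1) ^+ mdeg m *: D u m.

Definition is_trace (K : fieldType) (V : vectType K) (A : algType K)
    (iota : {linear V -> A}) (n : nat) (D : A -> series n A)
    (m : 'X_{1..n}) (t : K) : Prop :=
  forall xi : A, in_extpow iota n xi -> xi != 0 -> t *: xi = HS_coef D m xi.

(* (1 / k!) \sum_(s in S_n) F s, read as the sum over the s that are           *)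
(* increasing on the first k letters when k! is not invertible in K.           *)
Definition sum_over_fact (K : fieldType) (W : lmodType K) (n k : nat)
    (F : 'S_n -> W) : W :=
  if k`!%:R == 0 :> K then
    \sum_(s : 'S_n | [forall i : 'I_n, forall j : 'I_n,
                        (i < j < k)%N ==> (s i < s j)%N]) F s
  else (k`!%:R : K)^-1 *: \sum_(s : 'S_n) F s.

(* Letters are numbered from 0: sigma(1), ..., sigma(k) are the s j for j < k. *)
Definition mindex_head (n k : nat) (s : 'S_n) : 'X_{1..n} :=
  (\sum_(j < n | (j < k)%N) U_(s j))%MM.

Definition comp_tail (K : fieldType) (V : vectType K) (n : nat)
    (phi : 'I_n -> 'End(V)) (k : nat) (s : 'S_n) : 'End(V) :=
  \big[(@comp_lfun K V V V) / \1%VF]_(j < n | (k <= j)%N) phi (s j).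

(* Main.v *)
(* Write M = z_1 phi_1 + ... + z_n phi_n as a matrix over K[z_1, ..., z_n].     *)
(* On the top form, Dbar acts as multiplication by det(1 - M), so the traces   *)
(* are, up to sign, the coefficients of det(1 - M). Since char_poly M is       *)
(* homogeneous of degree n in z and 'X together, det(1 - M) also encodes all   *)
(* coefficients of char_poly M, and the identity is the coefficient of         *)
(* z_1 ... z_n in the Cayley-Hamilton theorem for M: the monomials of M ^+ p   *)
(* that divide z_1 ... z_n are indexed by the injective words of length p.     *)
Require Import Defs.
From HB Require Import structures.
From mathcomp Require Import all_boot all_order all_fingroup all_algebra.
From mathcomp Require Import mpoly.

Set Implicit Arguments.
Unset Strict Implicit.
Unset Printing Implicit Defensive.

Import GRing.Theory.
Local Open Scope ring_scope.

(** In a basis b of V, the series D(b_j) has as coordinates the j-th column of 1 - M. Multiplying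
    these n series, anticommutation leaves only the permutation terms, hence det(1 - M) times the
    top form ([anticomm_prod_det], [HS_top]). The top form is nonzero ([exterior_top_neq0]), so the
    traces are signed coefficients of det(1 - M) ([trace_det]). By homogeneity its coefficient at
    z^u is the one of z^u 'X^(n - |u|) in char_poly M ([det_pencil_coef]).

    In the coefficient of z_1 ... z_n of Cayley-Hamilton, each injective word w of length p
    contributes the product of the Phi (w j), weighted by the coefficient of det(1 - M) at the
    complementary monomial ([polarized_Cayley_Hamilton]). Injective words of length n - k are the
    tails of permutations, each occurring k! times ([sum_over_fact_tail_word]), and the
    complementary monomial is given by the head. *)

(** * Products of anticommuting families and determinants *)

Section AnticommutingFamilies.

Variables (B : pzRingType) (n : nat) (Y : 'I_n -> B).
Hypothesis Y_anti : forall i j, Y i * Y j = - (Y j * Y i).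
Hypothesis Y_sq : forall i, Y i * Y i = 0.

Lemma anticomm_prod_seq a s :
  Y a * \prod_(i <- s) Y i = (-1) ^+ size s * (\prod_(i <- s) Y i * Y a).
Proof.
elim: s => [|b s IHs]; first by rewrite big_nil mulr1 mul1r expr0 mul1r.
rewrite big_cons mulrA Y_anti mulNr -mulrA IHs /= exprS mulN1r mulNr.
by rewrite !mulrA (commr_sign (Y b)).
Qed.

Lemma ord_enum_split i j : i != j -> exists s1 s2 s3 : seq 'I_n,
  index_enum 'I_n = s1 ++ i :: s2 ++ j :: s3 \/
  index_enum 'I_n = s1 ++ j :: s2 ++ i :: s3.
Proof.
move=> neq_ij; have: j \in index_enum 'I_n by rewrite mem_index_enum.
have: i \in index_enum 'I_n by rewrite mem_index_enum.
case/path.splitPr=> s1 s2; rewrite mem_cat inE eq_sym (negPf neq_ij) /=.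
case/orP=> /path.splitPr[t1 t2]; last by exists s1, t1, t2; left.
by exists t1, t2, s2; right; rewrite -catA.
Qed.

Lemma anticomm_prod_tperm i j : i != j ->
  \prod_k Y (tperm i j k) = - \prod_k Y k.
Proof.
move=> neq_ij; have [s1 [s2 [s3 defE]]] := ord_enum_split neq_ij.
wlog defE1 : i j neq_ij defE / index_enum 'I_n = s1 ++ i :: s2 ++ j :: s3.
  move=> IH; case: (defE) => E; first exact: (IH i j).
  by rewrite tpermC; apply: (IH j i) => //; [rewrite eq_sym | left].
have : uniq (index_enum 'I_n) by rewrite index_enum_uniq.
rewrite defE1 cat_uniq /= cat_uniq /= !mem_cat !inE !negb_or.
case/and3P=> _ /andP[iNs1]; rewrite has_cat /= negb_or => /andP[_].
rewrite negb_or => /andP[jNs1 _] /andP[/and3P[iNs2 _ iNs3]].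
case/and3P=> _ /andP[jNs2 _] /andP[jNs3 _].
have tE s : i \notin s -> j \notin s ->
    \prod_(k <- s) Y (tperm i j k) = \prod_(k <- s) Y k.
  move=> iNs jNs; apply: eq_big_seq => k ks; rewrite tpermD //.
    by apply: contraNneq iNs => ->.
  by apply: contraNneq jNs => ->.
rewrite !(big_cat, big_cons) /= !tE // tpermL tpermR -mulrN.
congr (_ * _); rewrite !mulrA -mulNr; congr (_ * _).
(* Crossing the middle block [s2] costs the same sign on both sides, so only the exchange of [Y i]
   and [Y j] counts. *)
by rewrite !anticomm_prod_seq -!mulrA (Y_anti j i) !mulrN.
Qed.

(** The two equal factors are brought together to form a square. Anticommutation alone would only
    give that twice the square is 0, which says nothing in characteristic 2. *)
Lemma anticomm_prod_eq0 i j : i != j -> Y i = Y j -> \prod_k Y k = 0.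
Proof.
move=> neq_ij eqY; have [s1 [s2 [s3 defE]]] := ord_enum_split neq_ij.
have a0 a b : Y a = Y b -> Y a * (\prod_(k <- s2) Y k * (Y b * \prod_(k <- s3) Y k)) = 0.
  move=> eqab; rewrite mulrA anticomm_prod_seq -2!mulrA (mulrA (Y a)) -eqab.
  by rewrite Y_sq mul0r !mulr0.
by case: defE => ->; rewrite !(big_cat, big_cons) /= a0 ?mulr0.
Qed.

End AnticommutingFamilies.

Lemma anticomm_prod_perm (B : pzRingType) n (Y : 'I_n -> B) (s : 'S_n) :
    (forall i j, Y i * Y j = - (Y j * Y i)) ->
  \prod_k Y (s k) = (-1) ^+ s * \prod_k Y k.
Proof.
move=> Y_anti; have [ts -> dts] := prod_tpermP s.
elim: ts dts => [|t ts IHts] /= => [_|/andP[dt dts]].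
  by rewrite big_nil odd_perm1 mul1r; apply: eq_bigr => k _; rewrite perm1.
rewrite big_cons odd_mul_tperm dt.
under eq_bigr do rewrite permM.
by rewrite (@anticomm_prod_tperm _ _ (fun k => Y ((\prod_(i <- ts) tperm i.1 i.2)%g k))) //
   IHts // signr_addb expr1 mulN1r mulNr.
Qed.

(** Once the product of sums is distributed over all maps f, non-injective f repeat some [x l] and
    vanish; the others are permutations and give the Leibniz formula for the transpose. *)
Lemma anticomm_prod_det (C : comPzRingType) (B : pzRingType)
    (h : {rmorphism C -> B}) n (x : 'I_n -> B) (M : 'M[C]_n) :
    (forall c b, h c * b = b * h c) ->
    (forall i j, x i * x j = - (x j * x i)) -> (forall i, x i * x i = 0) ->
  \prod_j \sum_l (h (M l j) * x l) = h (\det M) * \prod_j x j.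
Proof.
move=> hC xN x0; rewrite bigA_distr_bigA /= (bigID (fun f : {ffun _ -> _} => injectiveb f)) /=.
have prodE (f : {ffun 'I_n -> 'I_n}) :
    \prod_i (h (M (f i) i) * x (f i)) = h (\prod_i M (f i) i) * \prod_i x (f i).
  elim/big_rec3: _ => [|i a b c _ ->]; first by rewrite rmorph1 mulr1.
  by rewrite rmorphM -!mulrA; congr (_ * _); rewrite !mulrA hC.
rewrite [X in _ + X]big1 ?addr0 => [|f /injectivePn[i [j neq_ij eqf]]]; last first.
  by rewrite prodE (@anticomm_prod_eq0 _ _ (fun k => x (f k)) _ _ i j) ?mulr0 ?eqf.
rewrite -det_tr /determinant rmorph_sum mulr_suml.
rewrite (reindex (fun s : 'S_n => val s)) /=; last first.
  exists (insubd (1%g : 'S_n)) => [s _|f injf]; first exact: valKd.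
  by rewrite insubdK.
apply: eq_big => [s|s _]; first exact: (valP s).
rewrite prodE pvalE anticomm_prod_perm // rmorphM rmorph_sign mulrA.
congr (_ * _); rewrite hC; congr (_ * h _).
by apply: eq_bigr => i _; rewrite mxE.
Qed.

(** * A matrix model detecting the top form *)

(* Creation operators: as the exterior algebra is only known through its       *)
(* universal property, these matrices are what shows that its top form is      *)
(* nonzero.                                                                    *)
Lemma creation_matrices (K : fieldType) n : exists N (a : nat -> 'M[K]_N.+1),
  [/\ forall i, (i < n)%N -> a i * a i = 0,
      forall i j, (i < n)%N -> (j < n)%N -> a i * a j = - (a j * a i)
    & \prod_(i < n) a i != 0].
Proof.
elim: n => [|n [N [a [a2 aN a0]]]].
  by exists 0%N, (fun=> 0); split=> //; rewrite big_ord0 oner_neq0.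
(* Jordan-Wigner doubling: the opposite signs on the diagonal of [d i] make it anticommute with [b],
   and a final factor [b] moves the old top product to the upper right block. *)
pose d i : 'M[K]_(N.+1 + N.+1) := block_mx (a i) 0 0 (- a i).
pose b : 'M[K]_(N.+1 + N.+1) := block_mx 0 1%:M 0 0.
exists (N + N.+1)%N, (fun i => if (i < n)%N then d i else b).
have dd i j : d i *m d j = block_mx (a i * a j) 0 0 (a i * a j).
  by rewrite /d mulmx_block !(mulmx0, mul0mx, addr0, add0r) mulNmx mulmxN opprK.
have bb : b *m b = 0.
  by rewrite /b mulmx_block !(mulmx0, mul0mx, addr0, add0r, mulmx1) block_mx0.
have db i : d i *m b = - (b *m d i).
  rewrite /d /b !mulmx_block !(mulmx0, mul0mx, addr0, add0r, mulmx1, mul1mx).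
  by rewrite [RHS]opp_block_mx !oppr0 opprK.
split=> [i ltin|i j ltin ltjn|].
- case: ifP => [/a2 ai2|_]; last exact: bb.
  by rewrite [LHS]dd ai2 block_mx0.
- case: ifP => lti; case: ifP => ltj.
  + rewrite [LHS]dd [X in - X]dd (aN i j) //.
    by apply: etrans (esym (opp_block_mx (a j * a i) 0 0 (a j * a i))); rewrite oppr0.
  + exact: db.
  + by rewrite [X in - X]db opprK.
  + by rewrite [LHS]bb [X in - X]bb oppr0.
have Md (P Q : 'M_N.+1) i :
    block_mx P 0 0 Q *m d i = block_mx (P * a i) 0 0 (- (Q * a i)).
  by rewrite /d mulmx_block !(mulmx0, mul0mx, addr0, add0r) mulmxN.
have Mb (P Q : 'M_N.+1) : block_mx P 0 0 Q *m b = block_mx 0 P 0 0.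
  by rewrite /b mulmx_block !(mulmx0, mul0mx, addr0, add0r, mulmx1).
have prodE m : (m <= n)%N -> exists Q : 'M_N.+1,
    \prod_(i < m) ((if (i < n)%N then d i else b) : 'M[K]_((N + N.+1).+1)) =
      block_mx (\prod_(i < m) a i) 0 0 Q.
  elim: m => [|m IHm] ltmn.
    by exists 1%:M; rewrite !big_ord0 -scalar_mx_block.
  have [Q E] := IHm (ltnW ltmn); exists (- (Q * a m)).
  by rewrite !big_ord_recr /= E ltmn [LHS]Md.
have [Q E] := prodE n (leqnn n).
rewrite big_ord_recr /= E ltnn; apply: contra_neq a0.
rewrite [X in X = _]Mb => /(congr1 (@ursubmx _ N.+1 N.+1 N.+1 N.+1)).
by rewrite block_mxKur => ->; apply/matrixP => i j; rewrite !mxE.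
Qed.

Lemma sum_anticomm_sqr (B : pzRingType) (I : Type) (r : seq I) (y : I -> B) :
    (forall i j, y i * y j = - (y j * y i)) -> (forall i, y i * y i = 0) ->
  (\sum_(i <- r) y i) * (\sum_(i <- r) y i) = 0.
Proof.
move=> yN y0; elim: r => [|i r IHr]; first by rewrite big_nil mul0r.
rewrite big_cons mulrDl !mulrDr IHr y0 add0r addr0 mulr_sumr mulr_suml.
by rewrite -big_split big1 //= => j _; rewrite yN addNr.
Qed.

Definition coord_comb (K : fieldType) (V : vectType K) (W : lmodType K) n
    (b : n.-tuple V) (a : 'I_n -> W) (v : V) : W := \sum_i coord b i v *: a i.

Lemma coord_comb_is_linear (K : fieldType) (V : vectType K) (W : lmodType K) n
    (b : n.-tuple V) (a : 'I_n -> W) : linear (coord_comb b a).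
Proof.
move=> c u v; rewrite /coord_comb scaler_sumr -big_split /=.
by apply: eq_bigr => i _; rewrite linearP scalerDl scalerA.
Qed.

HB.instance Definition _ (K : fieldType) (V : vectType K) (W : lmodType K) n
    (b : n.-tuple V) (a : 'I_n -> W) :=
  GRing.isLinear.Build K V W *:%R (coord_comb b a) (coord_comb_is_linear b a).

(** * The HS-derivation on the top form *)

Section Exterior.

Variables (K : fieldType) (V : vectType K) (n : nat) (b : n.-tuple V).
Hypothesis b_basis : basis_of fullv b.
Variables (A : algType K) (iota : {linear V -> A}).
Hypothesis extA : is_exterior_algebra iota.

Lemma exterior_sqr v : iota v * iota v = 0.
Proof. exact: extA.1. Qed.

Lemma exterior_anticomm u v : iota u * iota v = - (iota v * iota u).
Proof.
have := exterior_sqr (u + v); rewrite linearD mulrDl !mulrDr !exterior_sqr.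
by rewrite add0r addr0 => /eqP; rewrite addr_eq0 => /eqP.
Qed.

Lemma exterior_top_neq0 : \prod_(j < n) iota b`_j != 0.
Proof.
have [N [a [a0 aN aT]]] := creation_matrices K n.
pose f : {linear V -> 'M[K]_N.+1} := coord_comb b (fun i : 'I_n => a i).
have f0 v : f v * f v = 0.
  apply: sum_anticomm_sqr => [i j|i].
    by rewrite -!scalerAl -!scalerAr aN // !scalerN !scalerA (mulrC (coord b j v)).
  by rewrite -scalerAl -scalerAr a0 // !scaler0.
have [g gE _] := extA.2 _ f f0.
apply: contra_neq aT => /(congr1 g); rewrite rmorph0 rmorph_prod /= => <-.
apply: eq_bigr => j _; rewrite gE /f /= /coord_comb (bigD1 j) //=.
rewrite coord_free ?(basis_free b_basis) // eqxx scale1r big1 ?addr0 // => i neq_ij.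
by rewrite coord_free ?(basis_free b_basis) // eq_sym (negPf neq_ij) scale0r.
Qed.

(** Images of basis vectors are columns, so that composition becomes the matrix product in the same
    order. *)
Definition lfun_mx (f : 'End(V)) : 'M[K]_n := \matrix_(l, j) coord b l (f b`_j).

Definition pencil m (Phi : 'I_m -> 'M[K]_n) : 'M[{mpoly K[m]}]_n :=
  \sum_i 'X_i *: map_mx (@mpolyC m K) (Phi i).

Variables (m : nat) (phi : 'I_m -> 'End(V)) (D : A -> series m A).
Hypothesis HD : is_HS_of iota phi D.

(** On V the derivation is polynomial in z, so series can be replaced by polynomials with
    coefficients in [A]. *)
Definition lin_series (v : V) : {mpoly A[m]} :=
  (iota v)%:MP - \sum_i 'X_i * (iota (phi i v))%:MP.

Lemma HS_prod (vs : seq V) u :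
  D (\prod_(v <- vs) iota v) u = (\prod_(v <- vs) lin_series v)@_u.
Proof.
have [[_ D1 DM] DV] := HD.
elim: vs u => [|v vs IHvs] u.
  by rewrite !big_nil D1 /series1 mcoeff1; case: (u == 0%MM).
rewrite !big_cons DM mcoeffM /series_mul; apply: eq_bigr => k _.
rewrite DV IHvs; congr (_ * _); rewrite /id_sub_series /lin_series.
rewrite mcoeffB mcoeffC mulr_natr; congr (_ - _); rewrite raddf_sum /=.
apply: eq_bigr => i _; rewrite -commr_mpolyX mcoeffCM mcoeffX mulr_natr.
by rewrite eq_sym.
Qed.

Let h : {rmorphism {mpoly K[m]} -> {mpoly A[m]}} := map_mpoly (in_alg A).

(** [A] is not commutative, but scalars and variables are central: this is the centrality that
    [anticomm_prod_det] requires. *)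
Lemma map_in_alg_comm c (x : {mpoly A[m]}) : h c * x = x * h c.
Proof.
apply/mpolyP => u; rewrite mcoeffM mcoeffMr; apply: eq_bigr => k _.
by rewrite mcoeff_map_mpoly /= mulr_algl mulr_algr.
Qed.

Lemma lin_series_basis (j : 'I_n) :
  lin_series b`_j = \sum_l h ((1%:M - pencil (lfun_mx \o phi)) l j) * (iota b`_l)%:MP.
Proof.
have hE l : h ((1%:M - pencil (lfun_mx \o phi)) l j) =
    (l == j)%:R - \sum_i 'X_i * ((coord b l (phi i b`_j))%:A)%:MP.
  rewrite !mxE summxE rmorphB rmorph_nat rmorph_sum; congr (_ - _).
  by apply: eq_bigr => i _; rewrite !mxE rmorphM /= map_mpolyX map_mpolyC.
under eq_bigr do rewrite hE mulrBl.
rewrite sumrB (bigD1 j) //= eqxx mul1r big1 ?addr0 => [|l /negPf->]; last first.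
  by rewrite mul0r.
congr (_ - _); under [RHS]eq_bigr do rewrite mulr_suml.
rewrite exchange_big; apply: eq_bigr => i _ /=.
under eq_bigr do rewrite -mulrA -mpolyCM.
rewrite -mulr_sumr -rmorph_sum; congr (_ * _%:MP).
rewrite [in LHS](coord_basis b_basis (memvf (phi i b`_j))) linear_sum.
by apply: eq_bigr => l _; rewrite linearZ mulr_algl.
Qed.

Lemma HS_top u :
  D (\prod_(j < n) iota b`_j) u =
    (\det (1%:M - pencil (lfun_mx \o phi)))@_u *: \prod_(j < n) iota b`_j.
Proof.
have bigb (R : pzSemiRingType) (F : V -> R) : \prod_(v <- b) F v = \prod_(j < n) F b`_j.
  by rewrite big_tuple; apply: eq_bigr => j _; rewrite (tnth_nth 0).
rewrite -bigb HS_prod bigb (eq_bigr _ (fun j _ => lin_series_basis j)).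
rewrite (anticomm_prod_det (x := fun l : 'I_n => (iota b`_l)%:MP)).
- by rewrite map_in_alg_comm -rmorph_prod mcoeffCM mcoeff_map_mpoly /= mulr_algr bigb.
- exact: map_in_alg_comm.
- by move=> i j; rewrite -!mpolyCM exterior_anticomm mpolyCN.
- by move=> i; rewrite -mpolyCM exterior_sqr mpolyC0.
Qed.

End Exterior.

Lemma trace_det (K : fieldType) (V : vectType K) n (b : n.-tuple V)
    (A : algType K) (iota : {linear V -> A}) (phi : 'I_n -> 'End(V))
    (D : A -> series n A) (u : 'X_{1..n}) (t : K) :
    basis_of fullv b -> is_exterior_algebra iota -> is_HS_of iota phi D ->
    is_trace iota D u t ->
  (-1) ^+ mdeg u * t = (\det (1%:M - pencil (lfun_mx b \o phi)))@_u.
Proof.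
move=> b_basis extA HD trE; have top0 := exterior_top_neq0 b_basis extA.
have topE : in_extpow iota n (\prod_(j < n) iota b`_j).
  exists [:: (1, b)]; rewrite big_seq1 scale1r big_tuple.
  by apply: eq_bigr => j _; rewrite (tnth_nth 0).
have /eqP := trE _ topE top0.
rewrite /HS_coef (HS_top b_basis extA HD) scalerA -subr_eq0 -scalerBl scaler_eq0.
rewrite (negPf top0) orbF subr_eq0 => /eqP ->.
by rewrite mulrA -expr2 sqrr_sign mul1r.
Qed.

(** * Permutations modulo their head, and injective words *)

Section SumOverFact.

Variables (k p : nat).

Definition tail_word (s : 'S_(k + p)) : {ffun 'I_p -> 'I_(k + p)} :=
  [ffun j => s (rshift k j)].

Definition head_increasing (s : 'S_(k + p)) :=
  [forall i : 'I_(k + p), forall j : 'I_(k + p), (i < j < k)%N ==> (s i < s j)%N].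

Lemma tail_word_inj s : injectiveb (tail_word s).
Proof.
by apply/injectiveP => i j; rewrite !ffunE => /perm_inj /rshift_inj.
Qed.

Lemma mem_head (s : 'S_(k + p)) x :
  (x \in [seq s (lshift p j) | j <- enum 'I_k]) = (x \notin codom (tail_word s)).
Proof.
apply/mapP/idP => [[j _ ->]|].
  apply/negP => /codomP[l]; rewrite ffunE => /perm_inj/eqP.
  by rewrite eq_lrshift.
rewrite -[x](permKV s); case: (split_ordP (s^-1 x)%g) => j ->.
  by exists j; rewrite ?mem_enum.
by case/negP; apply/codomP; exists j; rewrite ffunE.
Qed.

(** The tail determines the set of head values, and a set has only one increasing listing. *)
Lemma head_increasing_unique s t :
  head_increasing s -> head_increasing t -> tail_word s = tail_word t -> s = t.
Proof.
move=> incs inct eqst; pose r m : rel 'I_m := relpre val ltn.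
have sorted_head u : head_increasing u ->
    sorted (@r _) [seq u (lshift p j) | j <- enum 'I_k].
  move=> /'forall_'forall_implyP incu; apply: (@homo_sorted _ _ _ (@r k)) => [i j ltij|].
    by apply: (incu (lshift p i) (lshift p j)); rewrite /= ltn_ord andbT.
  by rewrite -sorted_map val_enum_ord iota_ltn_sorted.
have /eq_in_map eqh : [seq s (lshift p j) | j <- enum 'I_k]
                    = [seq t (lshift p j) | j <- enum 'I_k].
  apply: (@irr_sorted_eq _ (@r (k + p))); try exact: sorted_head.
  - by move=> a b c; apply: ltn_trans.
  - by move=> a; apply: ltnn.
  - by move=> x; rewrite !mem_head eqst.
apply/permP => i; case: (split_ordP i) => j ->; first by rewrite eqh ?mem_enum.
by have /ffunP/(_ j) := eqst; rewrite !ffunE.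
Qed.

(** The witness lists the letters missing from [w] in increasing order, then [w] itself. *)
Lemma tail_word_surj (w : {ffun 'I_p -> 'I_(k + p)}) :
  injectiveb w -> exists2 s, head_increasing s & tail_word s = w.
Proof.
move=> /injectiveP injw.
pose L1 := [seq i <- enum 'I_(k + p) | i \notin codom w].
pose L := L1 ++ codom w.
have uL : uniq L.
  rewrite cat_uniq filter_uniq ?enum_uniq //= [uniq (codom w)]map_inj_uniq ?enum_uniq // andbT.
  by apply/hasPn => x xw; rewrite mem_filter xw.
have pL : perm_eq L (enum 'I_(k + p)).
  apply: uniq_perm; rewrite ?enum_uniq // => x.
  by rewrite mem_cat mem_filter mem_enum andbT orNb.
have szL : size L = (k + p)%N by rewrite (perm_size pL) size_enum_ord.
have szw : size (codom w) = p by rewrite size_codom card_ord.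
have szL1 : size L1 = k.
  by move: szL; rewrite size_cat szw => /addIn.
(* The default value is never reached, since [L] has size k + p. *)
have sinj : injective (fun i => nth i L i).
  move=> i j; rewrite (set_nth_default j) ?szL // => /eqP.
  by rewrite nth_uniq ?szL // => /eqP/val_inj.
exists (perm sinj).
  apply/'forall_'forall_implyP => i j /andP[ltij ltjk]; rewrite !permE.
  rewrite !nth_cat szL1 ltjk (ltn_trans ltij ltjk).
  rewrite (set_nth_default j) ?szL1 ?(ltn_trans ltij ltjk) //.
  pose r : rel 'I_(k + p) := relpre val ltn.
  apply: (@sorted_ltn_nth _ r _ j L1); rewrite ?inE ?szL1 ?(ltn_trans ltij ltjk) //.
    by move=> a b c; apply: ltn_trans.
  apply: sorted_filter; first by move=> a b c; apply: ltn_trans.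
  by rewrite -sorted_map val_enum_ord iota_ltn_sorted.
apply/ffunP => j; rewrite ffunE permE nth_cat szL1 /= ltnNge leq_addr /= addKn.
by rewrite (nth_map j) ?size_enum_ord // nth_ord_enum.
Qed.

(** The fibre through [s0] is the coset of [s0] under the permutations supported on the first k
    positions. *)
Lemma card_tail_word (w : {ffun 'I_p -> 'I_(k + p)}) :
  injectiveb w -> #|[pred s | tail_word s == w]| = k`!.
Proof.
move=> /tail_word_surj[s0 _ <-].
pose H : {set 'I_(k + p)} := [set lshift p j | j : 'I_k].
have cardH : #|H| = k by rewrite card_imset ?card_ord //; apply: lshift_inj.
rewrite -[in RHS]cardH -card_perm -[RHS](card_imset _ (mulIg s0)).
apply: eq_card => s; rewrite [LHS]unfold_in /=; apply/eqP/imsetP => [eqs|[t tH ->]].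
  exists (s * s0^-1)%g; last by rewrite mulgKV.
  apply/subsetP => i; rewrite inE permM; case: (split_ordP i) => j -> //.
    by move=> _; apply: imset_f.
  by have /ffunP/(_ j) := eqs; rewrite !ffunE => ->; rewrite permK eqxx.
apply/ffunP => j; rewrite !ffunE permM (out_perm tH) //.
by apply/imsetP => -[i _ /eqP]; rewrite eq_rlshift.
Qed.

(** Both readings of 1/k! choose one representative per fibre of [tail_word]: the increasing head
    does it directly, the division by averaging over the k! elements. *)
Lemma sum_over_fact_tail_word (K : fieldType) (W : lmodType K)
    (G : {ffun 'I_p -> 'I_(k + p)} -> W) :
  sum_over_fact k (G \o tail_word) = \sum_(w : {ffun 'I_p -> 'I_(k + p)} | injectiveb w) G w.
Proof.
rewrite /sum_over_fact; case: eqP => [_|/eqP kN0].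
  rewrite (partition_big tail_word
    (fun w : {ffun 'I_p -> 'I_(k + p)} => injectiveb w)) /= => [|s _];
    last exact: tail_word_inj.
  apply: eq_bigr => w /tail_word_surj[s incs <-].
  rewrite (big_pred1 s) // => t.
  apply/andP/eqP => [[inct /eqP]|->]; last by split=> //; exact: incs.
  exact: head_increasing_unique.
rewrite (partition_big tail_word
    (fun w : {ffun 'I_p -> 'I_(k + p)} => injectiveb w)) /= => [|s _];
    last exact: tail_word_inj.
rewrite scaler_sumr; apply: eq_bigr => w injw.
rewrite (eq_bigr (fun=> G w)) => [|s /eqP -> //].
rewrite sumr_const card_tail_word // -scaler_nat scalerA mulVf // scale1r //.
Qed.

End SumOverFact.

(** * Homogeneity of the characteristic polynomial of the pencil *)

Section PolarizedCharPoly.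

Variables (K : fieldType) (m : nat).

(* 'X and the variables of the coefficients all have degree 1. *)
Definition homog2 d (P : {poly {mpoly K[m]}}) :=
  forall j u, (mdeg u + j != d)%N -> P`_j@_u = 0.

Lemma homog2D d P Q : homog2 d P -> homog2 d Q -> homog2 d (P + Q).
Proof. by move=> hP hQ j u neq; rewrite coefD mcoeffD hP ?hQ ?addr0. Qed.

Lemma homog2N d P : homog2 d P -> homog2 d (- P).
Proof. by move=> hP j u neq; rewrite coefN mcoeffN hP ?oppr0. Qed.

Lemma homog2M (d e : nat) P Q :
  homog2 d P -> homog2 e Q -> homog2 (d + e)%N (P * Q).
Proof.
move=> hP hQ j u neq; rewrite coefM raddf_sum big1 //= => i _.
rewrite mcoeffM big1 // => -[u1 u2] /= /eqP defu.
have [degP|/hP->] := eqVneq (mdeg u1 + i)%N d; last by rewrite mul0r.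
rewrite (hQ (j - i)%N) ?mulr0 //; apply: contraNneq neq => degQ.
by rewrite defu mdegD -degP -degQ addnACA subnKC // -ltnS.
Qed.

Lemma homog2_prod n (P : 'I_n -> {poly {mpoly K[m]}}) :
  (forall i, homog2 1 (P i)) -> homog2 n (\prod_i P i).
Proof.
elim: n P => [|n IHn] P hP.
  move=> j u; rewrite big_ord0 coef1 mcoeffMn mcoeff1 -mdeg_eq0 addn_eq0.
  by case: j => [|j]; rewrite ?mulr0n // andbT => /negPf ->.
by rewrite big_ord_recl; apply: (@homog2M 1 n) => //; apply: IHn.
Qed.

Variables (n : nat) (Phi : 'I_m -> 'M[K]_n).
Let M := pencil Phi.

Lemma char_poly_mx_pencil_homog i j : homog2 1 (char_poly_mx M i j).
Proof.
rewrite !mxE; apply: homog2D => [k u|].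
  rewrite coefMn coefX !mcoeffMn mcoeff1 -mdeg_eq0.
  case: (k =P 1%N) => [->|_ _]; last by rewrite mulr0n mul0rn.
  by rewrite addn1 eqSS => /negPf->; rewrite !mul0rn.
apply: homog2N => k u; rewrite coefC; case: (k =P 0%N) => [->|_ _]; last exact: mcoeff0.
rewrite addn0 summxE raddf_sum => degu1; rewrite big1 //= => l _.
rewrite !mxE -commr_mpolyX mcoeffCM mcoeffX; case: eqP => [defu|_].
  by rewrite -defu mdeg1 in degu1.
by rewrite mulr0.
Qed.

Lemma char_poly_pencil_homog : homog2 n (char_poly M).
Proof.
rewrite /char_poly /determinant; elim/big_rec: _ => [j u _|s P _ hP].
  by rewrite coef0 mcoeff0.
have hs : homog2 n (\prod_i char_poly_mx M i (s i)).
  by apply: homog2_prod => i; apply: char_poly_mx_pencil_homog.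
by apply: homog2D hP; rewrite mulr_sign; case: ifP => _ //; apply: homog2N.
Qed.

(** Evaluating char_poly M at 'X = 1 loses nothing: by homogeneity a monomial z^u can only come from
    the power n - |u| of 'X. *)
Lemma det_pencil_coef u : (mdeg u <= n)%N ->
  (\det (1%:M - M))@_u = (char_poly M)`_(n - mdeg u)@_u.
Proof.
move=> ledn; have <- : (char_poly M).[1] = \det (1%:M - M).
  rewrite -/(horner_eval 1 _) -det_map_mx; congr (\det _); apply/matrixP=> i j.
  by rewrite !mxE /= /horner_eval hornerD hornerN hornerC hornerMn hornerX.
rewrite horner_coef size_char_poly raddf_sum /=.
have lt : (n - mdeg u < n.+1)%N by rewrite ltnS leq_subr.
rewrite (bigD1 (Ordinal lt)) //= big1 ?addr0 => [|j neqj]; rewrite expr1n mulr1 //.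
apply: char_poly_pencil_homog; apply: contra_neq neqj => degj.
by apply: val_inj; rewrite -[LHS](addKn (mdeg u)) degj.
Qed.

End PolarizedCharPoly.

(** * Words, their monomials, and the multilinear part of Cayley-Hamilton *)

Lemma mcoeffMXE (R : nzRingType) m (c : {mpoly R[m]}) (u v : 'X_{1..m}) :
  (c * 'X_[v])@_u = if (v <= u)%MM then c@_(u - v) else 0.
Proof.
case: ifPn => [levu|nlevu]; first by rewrite -{1}(submK levu) addmC mcoeffMX.
rewrite mcoeffM big1 // => k /eqP defu; rewrite mcoeffX; case: eqP => [defv|_].
  by case/negP: nlevu; rewrite defv [X in (_ <= X)%MM]defu lem_addl.
by rewrite mulr0.
Qed.

Definition full_mnm n : 'X_{1..n} := (\sum_(i < n) U_(i))%MM.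

Definition word_mnm n p (w : 'I_p -> 'I_n) : 'X_{1..n} := (\sum_(j < p) U_(w j))%MM.

Lemma full_mnmE n i : full_mnm n i = 1%N.
Proof.
rewrite /full_mnm mnm_sumE (bigD1 i) //= mnm1E eqxx big1 // => j /negPf neq.
by rewrite mnm1E neq.
Qed.

(** Exponents count occurrences of letters, so dividing z_1 ... z_n means that no letter is
    repeated. *)
Lemma word_mnm_le n p (w : {ffun 'I_p -> 'I_n}) :
  (word_mnm w <= full_mnm n)%MM = injectiveb w.
Proof.
apply/mnm_lepP/injectiveP => [lew i j eqw|injw i]; last first.
  rewrite full_mnmE mnm_sumE; case: (pickP (fun j => w j == i)) => [j /eqP defi|w'i].
    rewrite (bigD1 j) //= big1 => [|k neq]; rewrite mnm1E; first by case: eqP.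
    by rewrite -defi inj_eq // (negPf neq).
  by rewrite big1 // => j _; rewrite mnm1E w'i.
apply/eqP; apply: contraT => neq; have := lew (w i).
rewrite full_mnmE mnm_sumE (bigD1 i) //= (bigD1 j) /=; last by rewrite eq_sym.
by rewrite !mnm1E eqw eqxx.
Qed.

Lemma mdeg_word_compl n p (w : {ffun 'I_p -> 'I_n}) : injectiveb w ->
  mdeg (full_mnm n - word_mnm w) = (n - p)%N.
Proof.
rewrite -word_mnm_le => /submK /(congr1 mdeg); rewrite mdegD.
have degE q (v : 'I_q -> 'I_n) : mdeg (word_mnm v) = q.
  by rewrite mdeg_sum (eq_bigr (fun=> 1%N)) ?sum1_card ?card_ord // => j _; rewrite mdeg1.
(* The full monomial is that of the identity word, hence of degree n. *)
by rewrite degE (degE _ id) => degw; rewrite -[in RHS]degw addnK.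
Qed.

Lemma pencil_exp (K : fieldType) m n (Phi : 'I_m -> 'M[K]_n.+1) p :
  pencil Phi ^+ p = \sum_(w : {ffun 'I_p -> 'I_m})
    'X_[word_mnm w] *: map_mx (@mpolyC m K) (\prod_j Phi (w j)).
Proof.
transitivity (\prod_(j in 'I_p) pencil Phi); first by rewrite prodr_const card_ord.
rewrite /pencil bigA_distr_bigA; apply: eq_bigr => w _ /=; rewrite /word_mnm.
elim/big_rec3: _ => [|j x y z _ ->]; first by rewrite mpolyX0 scale1r rmorph1.
by rewrite mpolyXD rmorphM -scalerAl -scalerAr scalerA.
Qed.

(** The word w comes from M ^+ p and leaves a complementary monomial of degree n + 1 - p, which is
    exactly the degree for which [det_pencil_coef] returns the coefficient of 'X^p in char_poly
    M. *)
Lemma polarized_Cayley_Hamilton (K : fieldType) n (Phi : 'I_n.+1 -> 'M[K]_n.+1) :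
  \sum_(p < n.+2) \sum_(w : {ffun 'I_p -> 'I_n.+1} | injectiveb w)
    (\det (1%:M - pencil Phi))@_(full_mnm n.+1 - word_mnm w) *: \prod_j Phi (w j) = 0.
Proof.
have := Cayley_Hamilton (pencil Phi).
rewrite -[char_poly _]coefK poly_def size_char_poly linear_sum /=.
move=> CH; apply/matrixP => a b.
have /(congr1 (fun x => x@_(full_mnm n.+1))) := congr1 (fun A : 'M_n.+1 => A a b) CH.
rewrite !mxE mcoeff0 => <-; rewrite !summxE [RHS]raddf_sum; apply: eq_bigr => p _ /=.
rewrite linearZ rmorphXn /= horner_mx_X pencil_exp mxE !summxE mulr_sumr [RHS]raddf_sum.
rewrite big_mkcond; apply: eq_bigr => w _ /=.
rewrite [X in _ * X]mxE [X in _ * (_ * X)]mxE mulrA (mulrC _ _%:MP) mcoeffCM.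
rewrite mcoeffMXE word_mnm_le; case: ifP => injw; last by rewrite mulr0.
rewrite mxE det_pencil_coef mdeg_word_compl ?leq_subr // mulrC subKn //.
by rewrite -ltnS.
Qed.

(** * Passage from endomorphisms to matrices, and conclusion *)

(** As a monoid law, composition lets the iterated composition in [comp_tail] be split into head and
    tail. *)
HB.instance Definition _ (K : fieldType) (V : vectType K) :=
  Monoid.isLaw.Build 'End(V) \1%VF (@comp_lfun K V V V)
    (@comp_lfunA K V V V V) (@comp_lfun1l K V V) (@comp_lfun1r K V V).


Section LfunMx.

Variables (K : fieldType) (V : vectType K) (n : nat) (b : n.-tuple V).
Hypothesis b_basis : basis_of fullv b.

Lemma lfun_mx_is_linear : linear (lfun_mx b).
Proof. by move=> c f g; apply/matrixP=> i j; rewrite !mxE !lfunE /= lfunE linearP. Qed.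

Lemma lfun_mx_eq0 f : lfun_mx b f = 0 -> f = 0.
Proof.
move=> /matrixP f0; apply/lfunP => v; rewrite lfunE /=.
rewrite (coord_basis b_basis (memvf v)) linear_sum big1 // => j _.
rewrite linearZ /= (coord_basis b_basis (memvf (f _))) big1 ?scaler0 // => l _.
by have := f0 l j; rewrite !mxE => ->; rewrite scale0r.
Qed.

Lemma lfun_mx1 : lfun_mx b \1 = 1%:M.
Proof.
by apply/matrixP=> i j; rewrite !mxE lfunE coord_free ?(basis_free b_basis) // eq_sym.
Qed.

Lemma lfun_mx_comp f g : lfun_mx b (f \o g)%VF = lfun_mx b f *m lfun_mx b g.
Proof.
apply/matrixP=> i j; rewrite !mxE comp_lfunE.
rewrite (coord_basis b_basis (memvf (g _))) !linear_sum.
by apply: eq_bigr => l _; rewrite !linearZ /= !mxE mulrC.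
Qed.

End LfunMx.

HB.instance Definition _ (K : fieldType) (V : vectType K) n (b : n.-tuple V) :=
  GRing.isLinear.Build K 'End(V) 'M[K]_n *:%R (lfun_mx b) (lfun_mx_is_linear b).

Lemma eq_sum_over_fact (K : fieldType) (W : lmodType K) n k (F G : 'S_n -> W) :
  F =1 G -> sum_over_fact k F = sum_over_fact k G.
Proof.
move=> eqFG; rewrite /sum_over_fact.
by case: ifP => _; [|congr (_ *: _)]; apply: eq_bigr => s _.
Qed.

(** A permutation uses every letter once, so its head and tail monomials multiply to z_1 ... z_n. *)
Lemma mindex_head_compl k p (s : 'S_(k + p)) :
  mindex_head k s = (full_mnm (k + p) - word_mnm (tail_word s))%MM.
Proof.
have -> : full_mnm (k + p) = (mindex_head k s + word_mnm (tail_word s))%MM.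
  rewrite /full_mnm (reindex_inj (@perm_inj _ s)) /mindex_head /word_mnm /=.
  rewrite [in RHS]big_mkcond !big_split_ord /=.
  rewrite [X in (_ = _ + X + _)%MM]big1 ?addm0 => [|j _].
    congr (_ + _)%MM; apply: eq_bigr => j _; first by rewrite ltn_ord.
    by rewrite ffunE.
  by rewrite ltnNge leq_addr.
by rewrite addmK.
Qed.

Lemma comp_tail_word (K : fieldType) (V : vectType K) k p
    (phi : 'I_(k + p) -> 'End(V)) (s : 'S_(k + p)) :
  comp_tail phi k s = \big[(@comp_lfun K V V V) / \1%VF]_(j < p) phi (tail_word s j).
Proof.
rewrite /comp_tail big_mkcond big_split_ord /= big1 => [|j _].
  by rewrite comp_lfun1l; apply: eq_bigr => j _; rewrite leq_addr ffunE.
by rewrite leqNgt ltn_ord.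
Qed.

Lemma sum_over_fact_words (K : fieldType) (V : vectType K) n k p (phi : 'I_n -> 'End(V))
    (tau : 'X_{1..n} -> K) : n = (k + p)%N ->
  sum_over_fact k (fun s : 'S_n => tau (mindex_head k s) *: comp_tail phi k s)
  = \sum_(w : {ffun 'I_p -> 'I_n} | injectiveb w)
      tau (full_mnm n - word_mnm w)%MM *:
        \big[(@comp_lfun K V V V) / \1%VF]_(j < p) phi (w j).
Proof.
move=> defn; subst n; rewrite -sum_over_fact_tail_word.
by apply: eq_sum_over_fact => s; rewrite mindex_head_compl comp_tail_word.
Qed.

Theorem theorem4p8 (K : fieldType) (n : nat) (V : vectType K)
    (dimV : \dim {:V} = n)
    (A : algType K) (iota : {linear V -> A}) (extA : is_exterior_algebra iota)
    (phi : 'I_n -> 'End(V))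
    (Dbar : A -> series n A) (HDbar : is_HS_of iota phi Dbar)
    (tau : 'X_{1..n} -> K)
    (Htau : forall i : 'X_{1..n}, is_trace iota Dbar i (tau i)) :
  \sum_(k < n.+1)
     (-1) ^+ k *: sum_over_fact k
       (fun s : 'S_n => tau (mindex_head k s) *: comp_tail phi k s)
  = 0 :> 'End(V).
Proof.
have [b b_basis] : exists b : n.-tuple V, basis_of fullv b.
  by rewrite -dimV; exists (vbasis fullv); apply: vbasisP.
apply: (lfun_mx_eq0 b_basis).
(* In dimension 0 the matrices are empty; Cayley-Hamilton is applied in positive size. *)
case: n => [|n] in dimV phi Dbar HDbar tau Htau b b_basis *.
  by apply/matrixP => -[].
rewrite -[RHS](polarized_Cayley_Hamilton (lfun_mx b \o phi)) linear_sum.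
(* The summand k corresponds to words of length p = n + 1 - k, where the dimension is now n + 1. *)
rewrite [RHS](reindex_inj rev_ord_inj); apply: eq_bigr => k _ /=.
have lekn : (k <= n.+1)%N by rewrite -ltnS.
rewrite linearZ (@sum_over_fact_words _ _ _ k (n.+1 - k)) ?subnKC // linear_sum /=.
rewrite scaler_sumr subSS; apply: eq_bigr => w injw.
rewrite linearZ scalerA; congr (_ *: _).
  (* The complementary monomial has degree k, so the sign in [trace_det] is the (-1)^k of the
     statement. *)
  rewrite -(trace_det b_basis extA HDbar (Htau _)).
  by rewrite mdeg_word_compl // subKn.
by apply: (big_morph (lfun_mx b)); [apply: lfun_mx_comp | apply: lfun_mx1].
Qed.
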